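(* Let $\mathcal{H}$ be a complex Hilbert space, let $A\in\mathcal{B}(\mathcal{H})$ be positive semidefinite, let $\mathbb{A}=\begin{pmatrix} A & O \\ O & A \end{pmatrix}$ on $\mathcal{H}\oplus\mathcal{H}$, and let $P,Q,X,Y\in\mathcal{B}_A(\mathcal{H})$. Then for any $t\in\mathbb{R}\setminus\{0\}$ (and for each choice of the sign $\pm$), $$dw_A^2\left(PXQ^{\sharp_A}\pm QYP^{\sharp_A}\right)\le\left(t^2\|P\|_A^2+\frac1{t^2}\|Q\|_A^2\right)^2\left\{\left(t^2\|PX\|_A^2+\frac1{t^2}\|QY\|_A^2\right)^2+\alpha^2\right\},$$ where $\alpha=w_{\mathbb{A}}\begin{pmatrix} O & X \\ Y & O \end{pmatrix}$.
   Context: $\mathcal{B}(\mathcal{H})$ is the algebra of bounded linear operators on the complex Hilbert space $\mathcal{H}$; $O$ is the zero operator. For a positive semidefinite $A\in\mathcal{B}(\mathcal{H})$, put $\langle x,y\rangle_A=\langle Ax,y\rangle$ and $\|x\|_A=\sqrt{\langle x,x\rangle_A}$. $\mathcal{B}_A(\mathcal{H})$ is the set of $T\in\mathcal{B}(\mathcal{H})$ admitting an $A$-adjoint, i.e. such that $AS=T^*A$ has a solution $S\in\mathcal{B}(\mathcal{H})$; then $T^{\sharp_A}$ denotes the unique solution with $\mathcal{R}(T^{\sharp_A})\subseteq\overline{\mathcal{R}(A)}$ ($\mathcal{R}$ denotes range). Every $T\in\mathcal{B}_A(\mathcal{H})$ is $A$-bounded, i.e. $\|Tx\|_A\le c\|x\|_A$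 for all $x$ and some $c>0$. For $A$-bounded $T$: $\|T\|_A=\sup\{\|Tx\|_A:\|x\|_A=1\}$, $w_A(T)=\sup\{|\langle Tx,x\rangle_A|:\|x\|_A=1\}$, and $dw_A(T)=\sup\{\sqrt{|\langle Tx,x\rangle_A|^2+\|Tx\|_A^4}:\|x\|_A=1\}$, with $x$ ranging over $\mathcal{H}$. $w_{\mathbb{A}}$ is defined in the same way for $\mathbb{A}$-bounded operators on the Hilbert space $\mathcal{H}\oplus\mathcal{H}$ with the positive operator $\mathbb{A}$ in place of $A$. $dw_A^2(T)$ means $(dw_A(T))^2$. *)

(* Defs.v *)
From HB Require Import structures.
From mathcomp Require Import all_boot all_order all_algebra sesquilinear.
From mathcomp Require Import complex ring.
From mathcomp Require Import all_classical all_reals all_analysis.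

Set Implicit Arguments.
Unset Strict Implicit.
Unset Printing Implicit Defensive.

Import Order.TTheory GRing.Theory Num.Theory.
Import numFieldNormedType.Exports.

Local Open Scope classical_set_scope.
Local Open Scope complex_scope.
Local Open Scope ring_scope.

(* [inner] is linear in its first argument and conjugate-linear in the second. *)
HB.mixin Record CompleteNormedModule_isHilbert (R : realType) (H : Type)
    & CompleteNormedModule R[i] H := {
  inner : {dot H for (@Num.conj R[i])};
  innerE : forall x : H, inner x x = `|x| ^+ 2
}.

#[short(type="hilbertType")]
HB.structure Definition Hilbert (R : realType) :=
  {H of CompleteNormedModule R[i] H & CompleteNormedModule_isHilbert R H}.

(* The library norms [H * K] with the maximum of the two norms; the Hilbert
   direct sum therefore lives on an alias of the product. *)
Definition hsum (R : realType) (H K : hilbertType R) : Type := (H * K)%type.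

Section HilbertSum.
Context {R : realType} {H K : hilbertType R}.
Local Notation C := R[i].
Local Notation HK := (hsum H K).

HB.instance Definition _ := GRing.Lmodule.copy HK (H * K)%type.

Definition hsum_norm (z : HK) : C := sqrtC (`|z.1| ^+ 2 + `|z.2| ^+ 2).

Let sumsq_ge0 (a b : C) : 0 <= a -> 0 <= b -> 0 <= a ^+ 2 + b ^+ 2.
Proof. by move=> a0 b0; rewrite addr_ge0 ?exprn_ge0. Qed.

Lemma minkowski2 (a b c d : C) : 0 <= a -> 0 <= b -> 0 <= c -> 0 <= d ->
  sqrtC ((a + c) ^+ 2 + (b + d) ^+ 2) <=
  sqrtC (a ^+ 2 + b ^+ 2) + sqrtC (c ^+ 2 + d ^+ 2).
Proof.
move=> a0 b0 c0 d0.
have acbd0 : 0 <= a * c + b * d by rewrite addr_ge0 ?mulr_ge0.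
have cs : a * c + b * d <= sqrtC (a ^+ 2 + b ^+ 2) * sqrtC (c ^+ 2 + d ^+ 2).
  rewrite -(ler_pXn2r (n := 2)) ?nnegrE ?mulr_ge0 ?sqrtC_ge0 ?sumsq_ge0//.
  rewrite exprMn !sqrtCK -subr_ge0.
  have -> : (a ^+ 2 + b ^+ 2) * (c ^+ 2 + d ^+ 2) - (a * c + b * d) ^+ 2 =
            (a * d - b * c) ^+ 2 by ring.
  by rewrite real_exprn_even_ge0// rpredB// ger0_real// mulr_ge0.
rewrite -(ler_pXn2r (n := 2)) ?nnegrE ?addr_ge0 ?sqrtC_ge0 ?sumsq_ge0 ?addr_ge0//.
rewrite sqrtCK [leRHS]sqrrD !sqrtCK -subr_ge0.
set S := sqrtC _ * _ in cs *.
have -> : a ^+ 2 + b ^+ 2 + S *+ 2 + (c ^+ 2 + d ^+ 2) -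
   ((a + c) ^+ 2 + (b + d) ^+ 2) = (S - (a * c + b * d)) *+ 2 by ring.
by rewrite mulrn_wge0// subr_ge0.
Qed.

Let normD (x y : HK) : hsum_norm (x + y) <= hsum_norm x + hsum_norm y.
Proof.
apply: le_trans (minkowski2 _ _ _ _) => //.
rewrite ler_sqrtC ?qualifE/= ?sumsq_ge0 ?addr_ge0//.
by rewrite lerD// ler_pXn2r ?nnegrE ?addr_ge0// ler_normD.
Qed.

Let normZ (l : C) (x : HK) : hsum_norm (l *: x) = `|l| * hsum_norm x.
Proof.
rewrite /hsum_norm /= !normrZ !exprMn -mulrDr sqrtCM ?qualifE/=.
- by rewrite sqrCK.
- by rewrite exprn_ge0.
- by rewrite sumsq_ge0.
Qed.

Let norm0 (x : HK) : hsum_norm x = 0 -> x = 0.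
Proof.
move=> /eqP; rewrite sqrtC_eq0 paddr_eq0 ?exprn_ge0// !expf_eq0/= !normr_eq0.
by case: x => x1 x2 /= /andP[/eqP -> /eqP ->].
Qed.

HB.instance Definition _ :=
  Lmodule_isNormed.Build C HK normD normZ norm0.

Lemma hsum_normE (z : HK) : `|z| = sqrtC (`|z.1| ^+ 2 + `|z.2| ^+ 2).
Proof. by []. Qed.

Let norm1_le (z : HK) : `|z.1| <= `|z|.
Proof.
rewrite hsum_normE -[leLHS]sqrCK// ler_sqrtC ?qualifE/= ?sumsq_ge0 ?exprn_ge0//.
by rewrite lerDl exprn_ge0.
Qed.

Let norm2_le (z : HK) : `|z.2| <= `|z|.
Proof.
rewrite hsum_normE -[leLHS]sqrCK// ler_sqrtC ?qualifE/= ?sumsq_ge0 ?exprn_ge0//.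
by rewrite lerDr exprn_ge0.
Qed.

Let norm_le (z : HK) : `|z| <= `|z.1| + `|z.2|.
Proof.
rewrite hsum_normE -(ler_pXn2r (n := 2)) ?nnegrE ?addr_ge0 ?sqrtC_ge0 ?sumsq_ge0//.
rewrite sqrtCK sqrrD addrAC [leRHS]addrC lerDr.
by rewrite mulrn_wge0// mulr_ge0.
Qed.

Let complete_subproof (F : set_system HK) :
  ProperFilter F -> cauchy F -> cvg F.
Proof.
move=> FF Fc.
have c1 : cauchy ((fst : HK -> H) @ F).
  apply/cauchy_ballP => e e0; move/cauchy_ballP : Fc => /(_ e e0).
  rewrite !near_simpl => -[[A B] [FA FB] AB].
  exists (fst @` A, fst @` B).
    by split; [apply: (@filterS _ F _ A)|apply: (@filterS _ F _ B)] => // z; exists z.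
  move=> [x y] [/= [u Au <-] [v Bv <-]].
  have := AB (u, v) (conj Au Bv).
  by rewrite -!ball_normE/=; apply: le_lt_trans; exact: (norm1_le (u - v)).
have c2 : cauchy ((snd : HK -> K) @ F).
  apply/cauchy_ballP => e e0; move/cauchy_ballP : Fc => /(_ e e0).
  rewrite !near_simpl => -[[A B] [FA FB] AB].
  exists (snd @` A, snd @` B).
    by split; [apply: (@filterS _ F _ A)|apply: (@filterS _ F _ B)] => // z; exists z.
  move=> [x y] [/= [u Au <-] [v Bv <-]].
  have := AB (u, v) (conj Au Bv).
  by rewrite -!ball_normE/=; apply: le_lt_trans; exact: (norm2_le (u - v)).
have /cvg_ex [l1 F1] : cvg ((fst : HK -> H) @ F) by exact: cauchy_cvg.
have /cvg_ex [l2 F2] : cvg ((snd : HK -> K) @ F) by exact: cauchy_cvg.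
apply/cvg_ex; exists ((l1, l2) : HK).
apply/(@cvgrPdist_lt C HK) => e e0.
have e20 : 0 < e / 2 by rewrite divr_gt0.
move/cvgrPdist_lt : F1 => /(_ _ e20) F1.
move/cvgrPdist_lt : F2 => /(_ _ e20) F2.
near=> z.
rewrite (le_lt_trans (norm_le _))// (splitr e) ltrD//=; near: z.
- exact: F1.
- exact: F2.
Unshelve. all: by end_near. Qed.

HB.instance Definition _ := Uniform_isComplete.Build HK complete_subproof.

Definition hsum_inner (z w : HK) : C := inner z.1 w.1 + inner z.2 w.2.

Let inner_zmodl w : zmod_morphism (hsum_inner^~ w).
Proof. by move=> x y; rewrite /hsum_inner/= !linearBl/= opprD addrACA. Qed.

Let inner_zmodr z : zmod_morphism (hsum_inner z).
Proof. by move=> x y; rewrite /hsum_inner/= !linearBr/= opprD addrACA. Qed.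

Let inner_scalel w : scalable_for *%R (hsum_inner^~ w).
Proof. by move=> a x; rewrite /hsum_inner/= !linearZl_LR/= mulrDr. Qed.

Let inner_scaler z : scalable_for ((@Num.conj C) \; *%R) (hsum_inner z).
Proof. by move=> a x; rewrite /hsum_inner/= !linearZr_LR/= mulrDr. Qed.

HB.instance Definition _ := @isBilinear.Build C HK HK C
  *%R ((@Num.conj C) \; *%R) hsum_inner
  inner_zmodl inner_zmodr inner_scalel inner_scaler.

Let inner_herm (x y : HK) :
  hsum_inner x y = (-1) ^+ false * Num.conj (hsum_inner y x).
Proof.
rewrite expr0 mul1r /hsum_inner rmorphD/=.
by rewrite (hermC inner x.1) (hermC inner x.2) !expr0 !mul1r.
Qed.

HB.instance Definition _ := @isHermitianSesquilinear.Build C HK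
  false (@Num.conj C) hsum_inner inner_herm.

Let hsum_innerE (z : HK) : hsum_inner z z = `|z| ^+ 2.
Proof. by rewrite /hsum_inner !innerE hsum_normE sqrtCK. Qed.

Let inner_gt0 (z : HK) : z != 0 -> 0 < hsum_inner z z.
Proof. by move=> z0; rewrite hsum_innerE exprn_gt0// normr_gt0. Qed.

HB.instance Definition _ := @isDotProduct.Build C HK hsum_inner inner_gt0.

HB.instance Definition _ :=
  CompleteNormedModule_isHilbert.Build R HK hsum_innerE.

End HilbertSum.

Section Operators.
Context {R : realType}.

Definition block_op {H K : hilbertType R}
    (T11 : H -> H) (T12 : K -> H) (T21 : H -> K) (T22 : K -> K)
    (z : hsum H K) : hsum H K :=
  (T11 z.1 + T12 z.2, T21 z.1 + T22 z.2).

Context {H : hilbertType R}.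

Definition bounded_op (T : H -> H) : Prop :=
  linear T /\ exists c : R, forall x, `|T x| <= c%:C * `|x|.

(* [adjoint T] and [sharp A T] are definite descriptions: at most one operator
   satisfies the defining property, and one does when [T] is bounded (Riesz),
   resp. [A]-adjointable. *)
Definition adjoint (T : H -> H) : H -> H :=
  get [set S | bounded_op S /\ forall x y, inner (T x) y = inner x (S y)].

Definition positive_op (A : H -> H) : Prop :=
  bounded_op A /\ forall x, 0 <= inner (A x) x.

Definition A_adjoint (A T S : H -> H) : Prop :=
  bounded_op S /\ A \o S = adjoint T \o A.

Definition A_adjointable (A T : H -> H) : Prop :=
  bounded_op T /\ exists S, A_adjoint A T S.

Definition sharp (A T : H -> H) : H -> H :=
  get [set S | A_adjoint A T S /\ range S `<=` closure (range A)].

(* Real-valued: [inner (A x) x] is a nonnegative real for positive [A]. *)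
Definition A_inner (A : H -> H) (x y : H) : R[i] := inner (A x) y.

Definition A_norm (A : H -> H) (x : H) : R :=
  Num.sqrt (complex.Re (A_inner A x x)).

(* The supremum of the empty set, met only for [A = 0], is 0. *)
Definition A_opnorm (A T : H -> H) : R :=
  sup [set A_norm A (T x) | x in [set x | A_norm A x = 1]].

Definition A_numradius (A T : H -> H) : R :=
  sup [set complex.Re `|A_inner A (T x) x| | x in [set x | A_norm A x = 1]].

Definition A_DWradius (A T : H -> H) : R :=
  sup [set Num.sqrt (complex.Re `|A_inner A (T x) x| ^+ 2 + A_norm A (T x) ^+ 4)
      | x in [set x | A_norm A x = 1]].

End Operators.

(* Main.v *)
Require Import Defs.
From mathcomp Require Import all_boot all_order all_algebra sesquilinear.
From mathcomp Require Import complex ring lra.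
From mathcomp Require Import all_classical all_reals all_analysis.

(* Write u = P^# x and v = Q^# x, where |u|_A <= |P|_A |x|_A and
   |v|_A <= |Q|_A |x|_A, and let T = P X Q^# + e Q Y P^# with e = 1 or -1.
   Then <T x, x>_A = <X v, u>_A + e <Y u, v>_A, which up to a phase is the
   quadratic form of the off-diagonal block operator at (t u, (z / t) v) with
   |z| = 1 and (conj z)^2 = e, so its modulus is at most
   alpha (t^2 |u|_A^2 + |v|_A^2 / t^2).
   Besides, |T x|_A <= |PX|_A |v|_A + |QY|_A |u|_A is estimated by
   Cauchy-Schwarz with weights t and 1/t.
   The adjoints exist by the Riesz representation theorem and [sharp] by the
   orthogonal projection on the closure of the range of A. The suprema are
   finite because A-adjointable operators are A-bounded. *)

Set Implicit Arguments.
Unset Strict Implicit.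
Unset Printing Implicit Defensive.

Import Order.TTheory GRing.Theory Num.Theory.
Import numFieldNormedType.Exports.

Local Open Scope classical_set_scope.
Local Open Scope ring_scope.

Local Notation "x %:C" := (real_complex _ x) (format "x %:C") : ring_scope.

(** * Linear maps, the inner product and real scalars *)

Lemma linear_fun0 (K : pzRingType) (U V : lmodType K) (f : U -> V) :
  linear f -> f 0 = 0.
Proof.
by move=> fL; have := fL (-1) 0 0; rewrite scaler0 addr0 scaleN1r addNr.
Qed.

Lemma linear_funZ (K : pzRingType) (U V : lmodType K) (f : U -> V) a x :
  linear f -> f (a *: x) = a *: f x.
Proof. by move=> fL; rewrite -[a *: x]addr0 fL linear_fun0// addr0. Qed.

Lemma linear_funB (K : pzRingType) (U V : lmodType K) (f : U -> V) x y :
  linear f -> f (x - y) = f x - f y.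
Proof. by move=> fL; rewrite addrC -scaleN1r fL scaleN1r addrC. Qed.

Section Inner.
Context {R : realType} {H : hilbertType R}.
Implicit Types (x y z : H) (a : R[i]).

Lemma innerDl x y z : inner (x + y) z = inner x z + inner y z.
Proof. exact: linearDl. Qed.
Lemma innerDr x y z : inner x (y + z) = inner x y + inner x z.
Proof. exact: linearDr. Qed.
Lemma innerBl x y z : inner (x - y) z = inner x z - inner y z.
Proof. exact: linearBl. Qed.
Lemma innerBr x y z : inner x (y - z) = inner x y - inner x z.
Proof. exact: linearBr. Qed.
Lemma innerZl a x y : inner (a *: x) y = a * inner x y.
Proof. exact: linearZl_LR. Qed.
Lemma innerZr a x y : inner x (a *: y) = a^* * inner x y.
Proof. exact: linearZr_LR. Qed.
Lemma inner0l y : inner 0 y = 0.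
Proof. exact: linear0l. Qed.
Lemma inner0r y : inner y 0 = 0.
Proof. exact: linear0r. Qed.
Lemma innerC x y : inner x y = (inner y x)^*.
Proof. by rewrite (hermC inner x y) expr0 mul1r. Qed.
End Inner.

(** The discriminant argument behind Cauchy-Schwarz, in a form that allows [c = 0]: then, for
    [b != 0], the chosen [s] gives the expression the value -1. For [c > 0] take [s = c^-1]. *)
Lemma le_mul_of_quadratic_ge0 (R : realType) (a b c : R) :
  0 <= a -> 0 <= b -> 0 <= c ->
  (forall s, 0 <= a - 2 * s * b + s ^+ 2 * b * c) -> b <= a * c.
Proof.
move=> a0 b0 c0 h; have [c_eq0|c_neq0] := eqVneq c 0.
  have [->|b_neq0] := eqVneq b 0; first exact: mulr_ge0.
  have := h ((a + 1) / (2 * b)); rewrite c_eq0 mulr0 addr0.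
  rewrite (_ : 2 * _ * _ = a + 1); last by field.
  by rewrite opprD addrA subrr add0r oppr_ge0 ler10.
have c_gt0 : 0 < c by rewrite lt_def c_neq0.
have := h c^-1; rewrite (_ : _ + _ = (a * c - b) / c); last by field.
by rewrite pmulr_lge0 ?invr_gt0// subr_ge0.
Qed.

(** What makes [A_inner A] a semi-inner product. The identity is an instance, which yields the norm
    of [H] with real values as [A_norm idfun]; the diagonal block operator is another. *)
Definition nonneg_linear (R : realType) (H : hilbertType R) (A : H -> H) :=
  linear A /\ forall x, 0 <= inner (A x) x.

Lemma realcD (R : rcfType) (x y : R) : (x + y)%:C = x%:C + y%:C.
Proof. exact: rmorphD. Qed.
Lemma realcM (R : rcfType) (x y : R) : (x * y)%:C = x%:C * y%:C.
Proof. exact: rmorphM. Qed.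
Lemma realcX (R : rcfType) (x : R) n : (x ^+ n)%:C = x%:C ^+ n.
Proof. exact: rmorphXn. Qed.

Lemma Re_normK (R : rcfType) (z : R[i]) : (complex.Re `|z|)%:C = `|z|.
Proof. by rewrite RRe_real ?normr_real. Qed.

Lemma Re_norm_ge0 (R : rcfType) (z : R[i]) : 0 <= complex.Re `|z|.
Proof. by rewrite normc_def /= sqrtr_ge0. Qed.

(** * The semi-inner product of a nonnegative operator *)

Section SemiInner.
Context {R : realType} {H : hilbertType R}.
Context (A : H -> H) (posA : nonneg_linear A).
Implicit Types (x y z : H) (a : R[i]).

Lemma A_innerDl x y z : A_inner A (x + y) z = A_inner A x z + A_inner A y z.
Proof. by rewrite /A_inner -[x]scale1r posA.1 innerDl !scale1r. Qed.

Lemma A_innerDr x y z : A_inner A x (y + z) = A_inner A x y + A_inner A x z.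
Proof. exact: innerDr. Qed.

Lemma A_innerZl a x y : A_inner A (a *: x) y = a * A_inner A x y.
Proof. by rewrite /A_inner (linear_funZ _ _ posA.1) innerZl. Qed.

Lemma A_innerZr a x y : A_inner A x (a *: y) = a^* * A_inner A x y.
Proof. exact: innerZr. Qed.

(** Polarization: the form is real on the diagonal, and its imaginary parts at [x + y] and [x + i y]
    give the imaginary and the real part of the identity. *)
Lemma A_innerC x y : A_inner A x y = (A_inner A y x)^*.
Proof.
have im0 u : complex.Im (A_inner A u u) = 0 by exact/ger0_Im/posA.2.
have := im0 (x + y); have := im0 (x + 'i%C *: y).
rewrite !A_innerDl !A_innerDr !A_innerZl !A_innerZr.
rewrite !raddfD /= !im0.
case: (A_inner A x y) => [a b]; case: (A_inner A y x) => [c d] /=.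
have := im0 y; case: (A_inner A y y) => [p q] /= ->.
move=> h1 h2; apply/eqP; rewrite eq_complex /=.
by apply/andP; split; apply/eqP; lra.
Qed.

Lemma A_norm_ge0 x : 0 <= A_norm A x.
Proof. exact: sqrtr_ge0. Qed.

Lemma A_normE x : (A_norm A x ^+ 2)%:C = A_inner A x x.
Proof.
rewrite /A_norm sqr_sqrtr; first by apply/RRe_real/ger0_real/posA.2.
by have := posA.2 x; rewrite lecE => /andP[].
Qed.

Lemma A_normZ a x : A_norm A (a *: x) = complex.Re `|a| * A_norm A x.
Proof.
apply/eqP; rewrite -(@eqrXn2 _ 2) ?mulr_ge0 ?A_norm_ge0 ?Re_norm_ge0//.
apply/eqP.
apply: (@complexI R); rewrite A_normE A_innerZl A_innerZr -A_normE mulrA.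
by rewrite -normCK exprMn [RHS]realcM (realcX (complex.Re _)) Re_normK.
Qed.

Lemma A_normN x : A_norm A (- x) = A_norm A x.
Proof. by rewrite -scaleN1r A_normZ normrN normr1 mul1r. Qed.

(** The factor [A_inner A x y] absorbs the phase, which leaves the real quadratic in [s] of
    [le_mul_of_quadratic_ge0]. *)
Lemma A_norm_sub_inner x y (s : R) :
  A_norm A (x - (s%:C * A_inner A x y) *: y) ^+ 2 =
  A_norm A x ^+ 2 - 2 * s * complex.Re `|A_inner A x y| ^+ 2
    + s ^+ 2 * complex.Re `|A_inner A x y| ^+ 2 * A_norm A y ^+ 2.
Proof.
set b := A_inner A x y.
apply: (@complexI R); rewrite A_normE.
rewrite -scaleNr !A_innerDl !A_innerDr !A_innerZl !A_innerZr.
rewrite (A_innerC y x) -!A_normE -/b.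
have -> : (- (s%:C * b))^* = - (s%:C * b^*).
  by rewrite rmorphN rmorphM; congr (- (_ * _)); exact: conjc_real.
move: (A_norm A x ^+ 2) (A_norm A y ^+ 2) => p q.
have -> : (p - 2 * s * complex.Re `|b| ^+ 2
            + s ^+ 2 * complex.Re `|b| ^+ 2 * q)%:C =
          p%:C - 2 * s%:C * (b * b^*) + s%:C ^+ 2 * (b * b^*) * q%:C.
  rewrite -normCK -(Re_normK b) !expr2; move: (complex.Re _) => r.
  apply/eqP; rewrite eq_complex /=; apply/andP; split; apply/eqP; ring.
ring.
Qed.

Lemma A_cauchy_schwarz x y :
  complex.Re `|A_inner A x y| <= A_norm A x * A_norm A y.
Proof.
rewrite -(ler_pXn2r (n := 2)) ?nnegrE ?mulr_ge0 ?A_norm_ge0 ?Re_norm_ge0//.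
rewrite exprMn.
apply: le_mul_of_quadratic_ge0; rewrite ?sqr_ge0// => s.
by rewrite -A_norm_sub_inner sqr_ge0.
Qed.

Lemma A_normD x y : A_norm A (x + y) <= A_norm A x + A_norm A y.
Proof.
rewrite -(ler_pXn2r (n := 2)) ?nnegrE ?addr_ge0 ?A_norm_ge0//.
have -> : A_norm A (x + y) ^+ 2 =
    A_norm A x ^+ 2 + 2 * complex.Re (A_inner A x y) + A_norm A y ^+ 2.
  apply: (@complexI R); rewrite !rmorphD/= !A_normE !(A_innerDl, A_innerDr).
  rewrite (A_innerC y x) rmorphM rmorph_nat /= -addcJ.
  by rewrite -!addrA.
have := A_cauchy_schwarz x y.
have : complex.Re (A_inner A x y) <= complex.Re `|A_inner A x y|.
  rewrite -lecR Re_normK (le_trans _ (normc_ge_Re _))//.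
  by rewrite lecR ler_norm.
rewrite sqrrD mulr_natl; lra.
Qed.

End SemiInner.

(** * Orthogonal projection on the closure of a subspace *)

Section Projection.
Context {R : realType} {H : hilbertType R}.
Implicit Types (x y z m : H) (M : set H).

Local Notation hnorm := (A_norm (@idfun H)).

Lemma nonneg_linear_id : nonneg_linear (@idfun H).
Proof. by split=> // x; rewrite innerE exprn_ge0. Qed.
Local Notation posI := nonneg_linear_id.

Lemma hnormE x : (hnorm x)%:C = `|x|.
Proof.
apply/eqP; rewrite -(@eqrXn2 _ 2) ?lecR ?A_norm_ge0//; apply/eqP.
by rewrite -realcX (A_normE posI) /A_inner innerE.
Qed.

Lemma hnorm0_eq0 x : hnorm x = 0 -> x = 0.
Proof. by move=> x0; apply/eqP; rewrite -normr_eq0 -hnormE x0. Qed.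

Lemma closure_approx M y : closure M y ->
  forall e : R, 0 < e -> exists m, M m /\ hnorm (y - m) < e.
Proof.
move=> My e e0.
have /My[m [Mm]] : nbhs y (ball y e%:C) by apply: nbhsx_ballx; rewrite ltcR.
by rewrite -ball_normE/= -hnormE ltcR => ?; exists m.
Qed.

(** Since [f m = 0], [|f y| = |f (y - m)|] is at most [c] times the distance from [y] to [m], which
    can be made small. *)
Lemma bounded_vanish_closure (f : H -> R[i]) (c : R) M :
  (forall x y, f (x - y) = f x - f y) ->
  (forall x, complex.Re `|f x| <= c * hnorm x) ->
  (forall m, M m -> f m = 0) -> forall y, closure M y -> f y = 0.
Proof.
move=> fB fc fM y My; apply/eqP/negPn/negP => fy0.
have b0 : 0 < complex.Re `|f y| by rewrite -ltcR Re_normK normr_gt0.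
have c1 : 0 < `|c| + 1 by rewrite ltr_wpDl.
have [m [Mm]] := closure_approx My (divr_gt0 b0 c1).
rewrite ltr_pdivlMr// => lt; have := fc (y - m); rewrite fB (fM m)// subr0.
apply/negP; rewrite -ltNge; apply: le_lt_trans lt.
rewrite mulrC ler_wpM2l ?A_norm_ge0//.
by rewrite (le_trans (ler_norm c))// lerDl.
Qed.

Lemma parallelogram x y :
  hnorm (x + y) ^+ 2 + hnorm (x - y) ^+ 2 = 2 * (hnorm x ^+ 2 + hnorm y ^+ 2).
Proof.
apply: (@complexI R); rewrite [LHS]realcD [RHS]realcM [X in _ * X]realcD.
rewrite !(A_normE posI) /A_inner/=.
have -> : (2 : R)%:C = 2 by exact: rmorph_nat.
rewrite !(innerBl, innerBr, innerDl, innerDr); ring.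
Qed.

(* A minimizing sequence in [M] is Cauchy by the parallelogram law; its limit is
   the projection of [x] on the closure of [M]. *)
Lemma closure_projection M x :
  M 0 -> (forall a u v, M u -> M v -> M (a *: u + v)) ->
  exists y, closure M y /\ forall m, M m -> inner (x - y) m = 0.
Proof.
move=> M0 ML.
have MD u v : M u -> M v -> M (u + v).
  by move=> Mu; rewrite -[u]scale1r; exact: ML.
have MZ a u : M u -> M (a *: u).
  by move=> Mu; rewrite -[_ *: _]addr0; exact: ML.
pose E := [set hnorm (x - m) ^+ 2 | m in M]; pose d := inf E.
have E0 : has_inf E.
  split; first by exists (hnorm (x - 0) ^+ 2), 0.
  by exists 0 => _ [m _ <-]; exact: sqr_ge0.
have dE m : M m -> d <= hnorm (x - m) ^+ 2.
  by move=> Mm; apply: ge_inf; [exact: E0.2|exists m].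
have /choice[u uP] : forall n,
    exists m, M m /\ hnorm (x - m) ^+ 2 < d + n.+1%:R^-1.
  move=> n; have n0 : (0 : R) < n.+1%:R^-1 by rewrite invr_gt0.
  by have [_ [m Mm <-] ?] := inf_adherent n0 E0; exists m.
have uM n : M (u n) by have [] := uP n.
(* The midpoint of [u n] and [u k] lies in [M], so its squared distance to [x] is at least [d]. *)
have u_cauchy n k : hnorm (u n - u k) ^+ 2 <= 2 * (n.+1%:R^-1 + k.+1%:R^-1).
  have := parallelogram (x - u n) (x - u k).
  have -> : x - u n - (x - u k) = - (u n - u k).
    by rewrite opprB addrC addrA subrK opprB.
  have -> : x - u n + (x - u k) = 2 *: (x - 2^-1 *: (u n + u k)).
    rewrite scalerBr scalerA divff ?pnatr_eq0// scale1r scaler_nat mulr2n.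
    by rewrite opprD addrACA.
  rewrite (A_normN posI) (A_normZ posI).
  rewrite normr_nat (_ : complex.Re 2 = 2) // exprMn.
  have [_ hn] := uP n; have [_ hk] := uP k.
  have := dE _ (MZ 2^-1 _ (MD _ _ (uM n) (uM k))).
  move: hn hk; move: (n.+1%:R^-1) (k.+1%:R^-1) => i j; lra.
have small (e : R) : 0 < e -> exists n, forall k, (n <= k)%N -> k.+1%:R^-1 < e.
  move=> e0; exists (Num.truncn e^-1) => k nk.
  rewrite -[ltRHS]invrK ltf_pV2 ?posrE ?invr_gt0//.
  by rewrite (lt_le_trans (truncnS_gt _))// ler_nat ltnS.
have /cauchy_cvg/cvg_ex[y uy] : cauchy (u @ \oo).
  apply: cauchy_exP => e; rewrite ltcE/= => /andP[/eqP eIm e0].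
  have [n nP] := small _ (divr_gt0 (exprn_gt0 2 e0) (ltr0Sn R 3)).
  exists (u n), n => // k nk; rewrite -ball_normE/= -hnormE ltcE/= eIm eqxx/=.
  rewrite -(@ltr_pXn2r _ 2) ?nnegrE ?A_norm_ge0 ?(ltW e0)//.
  have := nP _ nk; have := nP _ (leqnn n); have := u_cauchy n k.
  move: (n.+1%:R^-1) (k.+1%:R^-1) => i j; lra.
have approx (e : R) : 0 < e ->
    exists n, n.+1%:R^-1 < e ^+ 2 /\ hnorm (y - u n) < e.
  move=> e0; have [n nP] := small _ (exprn_gt0 2 e0).
  have ec : 0 < e%:C by rewrite ltcR.
  move/cvgrPdist_lt : uy => /(_ _ ec)[k _ kP]; exists (maxn n k).
  split; first by apply: nP; exact: leq_maxl.
  by have := kP _ (leq_maxr n k); rewrite /= -hnormE ltcR.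
exists y; split.
  move=> B /nbhs_ballP [e]; rewrite /= ltcE/= => /andP[/eqP eIm e0] eB.
  have [n [_ ny]] := approx _ e0; exists (u n); split=> //; apply: eB.
  by rewrite -ball_normE/= -hnormE ltcE/= eIm eqxx.
move=> m Mm; apply/eqP/negPn/negP => xym.
set b := complex.Re `|inner (x - y) m|.
have b0 : 0 < b by rewrite -ltcR Re_normK normr_gt0.
have K0 : 0 <= hnorm m by exact: A_norm_ge0.
have K1 : 0 < 2 * (hnorm m + 1) by rewrite mulr_gt0// ltr_wpDl.
(* The limit [y] may lie outside [M], so the inner product is split at some [u n] in [M]. Both
   pieces are at most [s * hnorm m], and this [s] makes the total [b - 2 * s], below [b]. *)
pose s := b / (2 * (hnorm m + 1)).
have s0 : 0 < s by rewrite divr_gt0.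
have [n [n1 ny]] := approx _ s0.
(* Moving [u n] along [m] stays in [M], hence cannot lower the squared distance to [x] by [s ^ 2] or
   more: this is the quadratic inequality with [a = s ^ 2]. *)
have un : complex.Re `|inner (x - u n) m| <= s * hnorm m.
  rewrite -(ler_pXn2r (n := 2)) ?nnegrE ?Re_norm_ge0 ?(mulr_ge0 (ltW s0))//.
  rewrite exprMn; apply: le_mul_of_quadratic_ge0; rewrite ?sqr_ge0// => r.
  have := A_norm_sub_inner posI (x - u n) m r.
  set v := (r%:C * _) *: m; rewrite -[x - u n - v]addrA -opprD.
  have := dE _ (MD _ _ (uM n) (MZ (r%:C * A_inner idfun (x - u n) m) _ Mm)).
  have [_] := uP n; rewrite /A_inner/= -/v.
  move: n1; move: (n.+1%:R^-1) => i; lra.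
have yn : complex.Re `|inner (u n - y) m| <= s * hnorm m.
  apply: le_trans (A_cauchy_schwarz posI (u n - y) m) _; rewrite ler_wpM2r//.
  by rewrite -opprB (A_normN posI) ltW.
have : b <= s * hnorm m + s * hnorm m.
  apply: le_trans (lerD un yn); rewrite -lecR realcD !Re_normK.
  by apply: le_trans (ler_normD _ _); rewrite -innerDl addrA subrK.
suff : s * hnorm m + s * hnorm m < b by move=> /lt_geF ->.
have -> : s * hnorm m + s * hnorm m = b - 2 * s.
  by rewrite /s; field; rewrite gt_eqF// ltr_wpDl.
by rewrite gtrDl oppr_lt0 mulr_gt0.
Qed.
End Projection.

(** * Riesz representation, adjoints and [sharp] *)

Section Adjoint.
Context {R : realType} {H : hilbertType R}.
Implicit Types (x y z v w : H) (A S T : H -> H).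

Local Notation hnorm := (A_norm (@idfun H)).
Local Notation posI := nonneg_linear_id.

Lemma inner_inj v w : (forall x, inner x v = inner x w) -> v = w.
Proof.
move=> vw; apply/eqP; rewrite -subr_eq0; apply/eqP/hnorm0_eq0/eqP.
rewrite -(sqrf_eq0 (hnorm _)); apply/eqP/(@complexI R).
by rewrite (A_normE posI) /A_inner/= innerBr vw subrr.
Qed.

Lemma bounded_op_hnorm T : bounded_op T ->
  exists2 c : R, 0 <= c & forall x, hnorm (T x) <= c * hnorm x.
Proof.
move=> [_ [c cP]]; exists `|c| => // x.
apply: (@le_trans _ _ (c * hnorm x)).
  by rewrite -lecR realcM !hnormE.
by rewrite ler_wpM2r ?A_norm_ge0// ler_norm.
Qed.

Lemma hnorm_bounded_op T (c : R) : linear T ->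
  (forall x, hnorm (T x) <= c * hnorm x) -> bounded_op T.
Proof. by split=> //; exists c => x; rewrite -!hnormE -realcM lecR. Qed.

Lemma hnorm_pythagoras x y : inner x y = 0 ->
  hnorm (x + y) ^+ 2 = hnorm x ^+ 2 + hnorm y ^+ 2.
Proof.
move=> xy; apply: (@complexI R); rewrite [RHS]realcD !(A_normE posI) /A_inner/=.
by rewrite !(innerDl, innerDr) (innerC y x) xy conjC0 addr0 add0r.
Qed.

(** With [y] the projection of [x0] on the kernel, which is closed since [f] is bounded,
    [z = x0 - y] is orthogonal to the kernel and [f z != 0]. Every [v] differs from
    [(f v / f z) *: z] by an element of the kernel. *)
Lemma riesz (f : H -> R[i]) (c : R) :
  (forall a x y, f (a *: x + y) = a * f x + f y) ->
  (forall x, complex.Re `|f x| <= c * hnorm x) ->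
  exists w, forall v, f v = inner v w.
Proof.
move=> fL fc.
have f0 : f 0 = 0 by exact: (@linear_fun0 _ _ R[i]^o f fL).
have fB x y : f (x - y) = f x - f y.
  exact: (@linear_funB _ _ R[i]^o f x y fL).
have fZ a x : f (a *: x) = a * f x by exact: (@linear_funZ _ _ R[i]^o f a x fL).
have [[x0 fx0]|f_eq0] := pselect (exists x, f x != 0); last first.
  exists 0 => v; rewrite inner0r; apply/eqP/negPn/negP => fv.
  by apply: f_eq0; exists v.
have [||y [yM yP]] := @closure_projection _ _ [set x | f x = 0] x0 => //=.
  by move=> a u v; rewrite fL => -> ->; rewrite mulr0 addr0.
have fy : f y = 0 by apply: (bounded_vanish_closure fB fc _ yM).
set z := x0 - y in yP.
have fz : f z != 0 by rewrite fB fy subr0.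
have zz : inner z z != 0.
  rewrite innerE expf_eq0/= normr_eq0; apply: contraNneq fz => ->.
  by rewrite f0.
exists ((f z / inner z z)^* *: z) => v.
rewrite innerZr conjCK.
have : inner z (v - (f v / f z) *: z) = 0.
  by apply: yP; rewrite /= fB fZ divfK// subrr.
rewrite innerC => /eqP; rewrite conjC_eq0 innerBl innerZl subr_eq0 => /eqP ->.
by field; apply/andP.
Qed.

(** Riesz gives the values of [S]. A bound [c] of [T] carries over:
    [|S y|^2 = <T (S y), y> <= c |S y| |y|], and [|S y|] cancels. *)
Lemma adjointP T : bounded_op T ->
  bounded_op (adjoint T) /\
  forall x y, inner (T x) y = inner x (adjoint T y).
Proof.
move=> bT; rewrite /adjoint.
pose D := [set S | bounded_op S /\ forall x y, inner (T x) y = inner x (S y)].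
apply: (@xgetPex _ _ D).
have [c c0 cP] := bounded_op_hnorm bT.
have /choice[S SP] : forall y, exists w, forall x, inner (T x) y = inner x w.
  move=> y; apply: (@riesz (fun x => inner (T x) y) (c * hnorm y)).
    by move=> a u v; rewrite bT.1 innerDl innerZl.
  move=> x; apply: le_trans (A_cauchy_schwarz posI (T x) y) _.
  by rewrite mulrAC ler_wpM2r ?A_norm_ge0.
exists S; split; last by move=> x y.
have SL : linear S.
  move=> a u v; apply: inner_inj => x.
  by rewrite -SP !innerDr !innerZr !SP.
apply: (@hnorm_bounded_op _ c) => // y.
have [->|Sy] := eqVneq (hnorm (S y)) 0; first by rewrite mulr_ge0 ?A_norm_ge0.
have Sy0 : 0 < hnorm (S y) by rewrite lt_def Sy A_norm_ge0.
rewrite -(ler_pM2l Sy0) -expr2.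
have -> : hnorm (S y) ^+ 2 = complex.Re `|inner (T (S y)) y|.
  apply: (@complexI R); rewrite Re_normK SP (A_normE posI) /A_inner/=.
  by rewrite innerE ger0_norm// exprn_ge0.
apply: le_trans (A_cauchy_schwarz posI (T (S y)) y) _.
by rewrite mulrCA mulrA ler_wpM2r ?A_norm_ge0.
Qed.

Lemma positive_nonneg_linear A : positive_op A -> nonneg_linear A.
Proof. by move=> [[AL _] Age0]; split. Qed.

(** Any [A]-adjoint [S] can be followed by the orthogonal projection [P] on the closure of the range
    of [A]: the equation survives because [A \o P = A]. *)
Lemma sharpP A T : positive_op A -> A_adjointable A T ->
  A_adjoint A T (sharp A T).
Proof.
move=> posA [bT [S [bS AS]]].
suff : exists S', A_adjoint A T S' /\ range S' `<=` closure (range A).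
  by move=> /xgetPex -/(_ point)[].
have nnA := positive_nonneg_linear posA.
have AB x y : A (x - y) = A x - A y by exact/linear_funB/nnA.1.
have ker_orth k : A k = 0 -> forall y, closure (range A) y -> inner y k = 0.
  move=> Ak; apply: (@bounded_vanish_closure _ _ (fun y => inner y k) (hnorm k)).
  - by move=> x y; rewrite innerBl.
  - by move=> x; rewrite mulrC; exact: A_cauchy_schwarz posI x k.
  - move=> _ [v _ <-]; rewrite -/(A_inner A v k) (A_innerC nnA).
    by rewrite /A_inner Ak inner0l conjC0.
have /choice[P PP] : forall x, exists y, closure (range A) y /\
    forall m, range A m -> inner (x - y) m = 0.
  move=> x; apply: closure_projection.
    by exists 0 => //; exact/linear_fun0/nnA.1.
  by move=> a _ _ [u _ <-] [v _ <-]; exists (a *: u + v) => //; rewrite nnA.1.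
have AP x : A (P x) = A x.
  apply/eqP; rewrite eq_sym -subr_eq0 -AB; apply/eqP/inner_inj => v.
  rewrite inner0r innerC; apply/eqP; rewrite conjC_eq0.
  rewrite -/(A_inner A _ v) (A_innerC nnA) conjC_eq0 /A_inner innerC conjC_eq0.
  by apply/eqP/(PP x).2; exists v.
have PPx x : inner (x - P x) (P x) = 0.
  rewrite innerC; apply/eqP; rewrite conjC_eq0; apply/eqP.
  by apply: ker_orth; [rewrite AB AP subrr|exact: (PP x).1].
exists (P \o S); split; last by move=> _ [x _ <-]; exact: (PP (S x)).1.
split; last by rewrite -AS; apply/funext => x /=; rewrite AP.
have [c c0 cP] := bounded_op_hnorm bS.
apply: (@hnorm_bounded_op _ c) => [a u v|x] /=.
  (* [P] comes from choice, so linearity needs a proof. The defect [d] lies in the kernel of [A] and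
     is a combination of values of [P], which are orthogonal to that kernel; hence [<d, d> = 0]. *)
  apply/eqP; rewrite -subr_eq0; apply/eqP; set d := _ - _.
  have Ad : A d = 0 by rewrite AB AP bS.1 !nnA.1 !AP subrr.
  apply: hnorm0_eq0; apply/eqP; rewrite -(sqrf_eq0 (hnorm d)).
  apply/eqP/(@complexI R); rewrite (A_normE posI) /A_inner/=.
  have dk y : inner (P y) d = 0 by apply: ker_orth => //; exact: (PP y).1.
  by rewrite {1}/d innerBl innerDl innerZl !dk mulr0 addr0 subr0.
(* By Pythagoras, [P] does not increase the norm. *)
apply: le_trans (cP x).
rewrite -(ler_pXn2r (n := 2)) ?nnegrE ?A_norm_ge0//.
by rewrite -[in leRHS](subrK (P (S x)) (S x)) hnorm_pythagoras// lerDr sqr_ge0.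
Qed.

Lemma A_adjoint_inner A T S x y : positive_op A -> bounded_op T ->
  A_adjoint A T S -> A_inner A (T x) y = A_inner A x (S y).
Proof.
move=> /positive_nonneg_linear nnA bT [_ /(congr1 (@^~ y))/= AS].
rewrite (A_innerC nnA) (A_innerC nnA x) /A_inner AS -!innerC.
exact: (adjointP bT).2.
Qed.

End Adjoint.

(** If [c < s], then [s / c = 1 + q] with [q > 0], and by Bernoulli [(s / c) ^ (2 ^ n)] is at least
    [n q], which eventually exceeds [K]. The exponents [2 ^ n] come from repeated squaring. *)
Lemma le_of_expr_le (R : archiRealFieldType) (s c K : R) : 0 <= s -> 0 <= c ->
  (forall n, s ^+ (2 ^ n) <= K * c ^+ (2 ^ n)) -> s <= c.
Proof.
move=> s0 c0 h; rewrite leNgt; apply/negP => cs.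
have c_gt0 : 0 < c.
  rewrite lt_def c0 andbT; apply: contraTneq cs => c_eq0.
  by have := h 0%N; rewrite expn0 !expr1 c_eq0 mulr0 -leNgt.
pose q := s / c - 1.
have q0 : 0 < q by rewrite subr_gt0 ltr_pdivlMr// mul1r.
have qK n : n%:R * q <= K.
  apply: (@le_trans _ _ ((s / c) ^+ (2 ^ n))); last first.
    by rewrite expr_div_n ler_pdivrMr ?exprn_gt0.
  have -> : s / c = 1 + q by rewrite addrC subrK.
  have le1 m : m%:R * q <= (1 + q) ^+ m.
    elim: m => [|m IH]; first by rewrite mul0r expr0.
    have q1 : 1 <= (1 + q) ^+ m by rewrite exprn_ege1// lerDl ltW.
    rewrite exprS mulrDl mul1r mulrSr mulrDl mul1r lerD//.
    by rewrite ler_peMr// ltW.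
  apply: le_trans (le1 _); rewrite ler_wpM2r ?(ltW q0)// ler_nat.
  exact/ltnW/ltn_expl.
have := qK (Num.truncn (K / q)).+1; apply/negP.
by rewrite -ltNge -ltr_pdivrMr// truncnS_gt.
Qed.

Lemma sup_ge0 (R : realType) (E : set R) :
  (forall x, E x -> 0 <= x) -> 0 <= sup E.
Proof.
move=> E0; have [supE|/sup_out ->//] := pselect (has_sup E).
have [x Ex] := supE.1; exact: le_trans (E0 _ Ex) (ub_le_sup supE.2 Ex).
Qed.

(** * Boundedness in the seminorm and finiteness of the suprema *)

Section ABounded.
Context {R : realType} {H : hilbertType R}.
Implicit Types (x y z : H) (A S T : H -> H).

(** The bound concerns all vectors: it makes the images of null vectors null, which suprema over
    unit vectors do not show. *)
Definition A_bounded A T := linear T /\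
  exists2 c : R, 0 <= c & forall x, A_norm A (T x) <= c * A_norm A x.

Lemma A_bounded_comp A S T :
  A_bounded A S -> A_bounded A T -> A_bounded A (S \o T).
Proof.
move=> [SL [c c0 cP]] [TL [d d0 dP]]; split.
  by move=> a x y; rewrite /= TL SL.
exists (c * d) => [|x /=]; first exact: mulr_ge0.
by rewrite (le_trans (cP _))// -mulrA ler_wpM2l.
Qed.

Lemma A_opnorm_ge0 A T : 0 <= A_opnorm A T.
Proof. by apply: sup_ge0 => _ [x _ <-]; exact: A_norm_ge0. Qed.

Lemma A_numradius_ge0 A T : 0 <= A_numradius A T.
Proof. by apply: sup_ge0 => _ [x _ <-]; exact: Re_norm_ge0. Qed.

Lemma A_DWradius_ge0 A T : 0 <= A_DWradius A T.
Proof. by apply: sup_ge0 => _ [x _ <-]; exact: sqrtr_ge0. Qed.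

Context (A : H -> H) (nnA : nonneg_linear A).

Lemma A_normalize x : A_norm A x != 0 -> exists2 y,
  A_norm A y = 1 & x = (A_norm A x)%:C *: y.
Proof.
move=> x0; exists ((A_norm A x)^-1%:C *: x).
  rewrite (A_normZ nnA) ger0_norm; last by rewrite ler0c invr_ge0 A_norm_ge0.
  by rewrite mulVf.
by rewrite scalerA -realcM divff// scale1r.
Qed.

Lemma A_normZr (r : R) x : 0 <= r -> A_norm A (r%:C *: x) = r * A_norm A x.
Proof. by move=> r0; rewrite (A_normZ nnA) ger0_norm ?ler0c. Qed.

Lemma A_norm_le_opnorm T x : A_bounded A T ->
  A_norm A (T x) <= A_opnorm A T * A_norm A x.
Proof.
move=> [TL [c c0 cP]]; have [x0|x0] := eqVneq (A_norm A x) 0.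
  by have := cP x; rewrite x0 !mulr0.
have [y y1 ->] := A_normalize x0.
rewrite (linear_funZ _ _ TL) !A_normZr ?A_norm_ge0// y1 mulr1 mulrC.
rewrite ler_wpM2r ?A_norm_ge0//.
apply: ub_le_sup; last by exists y.
by exists c => _ [z /= z1 <-]; rewrite (le_trans (cP z))// z1 mulr1.
Qed.

Lemma A_inner_le_numradius T x : A_bounded A T ->
  complex.Re `|A_inner A (T x) x| <= A_numradius A T * A_norm A x ^+ 2.
Proof.
move=> [TL [c c0 cP]]; have [x0|x0] := eqVneq (A_norm A x) 0.
  by have := A_cauchy_schwarz nnA (T x) x; rewrite x0 expr0n !mulr0.
have [y y1 {1 2}->] := A_normalize x0; set r := A_norm A x.
rewrite (linear_funZ _ _ TL) A_innerZl// A_innerZr.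
have -> : r%:C^* = r%:C by exact: conjc_real.
rewrite mulrA -realcM normrM ger0_norm; last first.
  by rewrite ler0c mulr_ge0 ?A_norm_ge0.
rewrite -[`|A_inner _ _ _|]Re_normK -realcM -expr2 /= mulrC.
rewrite ler_wpM2r ?sqr_ge0//.
apply: ub_le_sup; last by exists y.
exists c => _ [z /= z1 <-].
rewrite (le_trans (A_cauchy_schwarz nnA _ _))// z1 mulr1.
by have := cP z; rewrite z1 mulr1.
Qed.

End ABounded.

Section AAdjointable.
Context {R : realType} {H : hilbertType R}.
Context (A : H -> H) (posA : positive_op A).
Implicit Types (x y z : H) (S T : H -> H).

Let nnA := positive_nonneg_linear posA.
Local Notation hnorm := (A_norm (@idfun H)).

Lemma A_norm_le_hnorm : exists2 K : R, 0 <= K &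
  forall x, A_norm A x <= K * hnorm x.
Proof.
have [c c0 cP] := bounded_op_hnorm posA.1.
exists (Num.sqrt c) => [|x]; first exact: sqrtr_ge0.
rewrite -(ler_pXn2r (n := 2)) ?nnegrE ?mulr_ge0 ?A_norm_ge0 ?sqrtr_ge0//.
rewrite exprMn (sqr_sqrtr c0) [in leRHS]expr2 mulrA.
have -> : A_norm A x ^+ 2 = complex.Re `|inner (A x) x|.
  apply: (@complexI R); rewrite Re_normK (A_normE nnA) ger0_norm//.
  exact: posA.2.
apply: le_trans (A_cauchy_schwarz nonneg_linear_id (A x) x) _.
by rewrite ler_wpM2r ?A_norm_ge0.
Qed.

(* [B := S \o T] satisfies [|B^k x|_A^2 <= |B^(2k) x|_A |x|_A], so that
   [|B x|_A^(2^n)] is bounded by [|B^(2^n) x|_A], hence by a constant times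
   [c^(2^n)] for a bound [c] of [B] in the norm of [H]. *)
Lemma A_adjointable_A_bounded T : A_adjointable A T -> A_bounded A T.
Proof.
move=> [bT [S adjS]]; have bS := adjS.1; split; first exact: bT.1.
have TS x y : A_inner A (T x) y = A_inner A x (S y) by exact: A_adjoint_inner.
have [cT cT0 cTP] := bounded_op_hnorm bT.
have [cS cS0 cSP] := bounded_op_hnorm bS.
have [K K0 KP] := A_norm_le_hnorm.
pose B := S \o T; pose c := cS * cT.
have c0 : 0 <= c by exact: mulr_ge0.
(* [B] is symmetric for [A_inner A], because [<S T x, y> = <T x, T y>]. *)
have BB k x y : A_inner A (iter k B x) y = A_inner A x (iter k B y).
  elim: k y => //= k IH y; rewrite (A_innerC nnA) /B /= -TS.
  by rewrite -(A_innerC nnA) TS IH -iterSr.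
have Bc k x : hnorm (iter k B x) <= c ^+ k * hnorm x.
  elim: k => [|k IH]; first by rewrite expr0 mul1r.
  rewrite iterS exprS -mulrA (le_trans (cSP _))// /c -!mulrA ler_wpM2l//.
  by rewrite (le_trans (cTP _))// ler_wpM2l.
have sqB k x : A_norm A (iter k B x) ^+ 2 <=
    A_norm A (iter (k + k) B x) * A_norm A x.
  have -> : A_norm A (iter k B x) ^+ 2 =
      complex.Re `|A_inner A (iter (k + k) B x) x|.
    apply: (@complexI R); rewrite Re_normK iterD BB -(A_normE nnA).
    by rewrite ger0_norm// ler0c sqr_ge0.
  exact: A_cauchy_schwarz.
have sqT x : A_norm A (T x) ^+ 2 <= A_norm A (B x) * A_norm A x.
  have -> : A_norm A (T x) ^+ 2 = complex.Re `|A_inner A x (B x)|.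
    apply: (@complexI R); rewrite Re_normK -TS -(A_normE nnA).
    by rewrite ger0_norm// ler0c sqr_ge0.
  by rewrite mulrC; exact: A_cauchy_schwarz.
have Bunit x : A_norm A x = 1 -> A_norm A (B x) <= c.
  (* The factor [K * hnorm x] depends on [x], but it is absent from the resulting bound [c]. *)
  move=> x1; apply: (@le_of_expr_le _ _ _ (K * hnorm x)) => //.
    exact: A_norm_ge0.
  move=> n.
  apply: (@le_trans _ _ (A_norm A (iter (2 ^ n) B x))); last first.
    by rewrite (le_trans (KP _))// -mulrA ler_wpM2l// mulrC.
  elim: n => [|n IH]; first by rewrite expn0 expr1.
  rewrite expnSr exprM muln2 -addnn.
  have := sqB (2 ^ n)%N x; rewrite x1 mulr1; apply: le_trans.
  by rewrite ler_pXn2r ?nnegrE ?exprn_ge0 ?A_norm_ge0.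
exists (Num.sqrt c) => [|x]; first exact: sqrtr_ge0.
rewrite -(ler_pXn2r (n := 2)) ?nnegrE ?mulr_ge0 ?A_norm_ge0 ?sqrtr_ge0//.
apply: le_trans (sqT x) _; rewrite exprMn (sqr_sqrtr c0) [in leRHS]expr2 mulrA.
rewrite ler_wpM2r ?A_norm_ge0//.
have [x0|x0] := eqVneq (A_norm A x) 0.
  have := sqB 1%N x; rewrite x0 !mulr0 /=.
  by rewrite le_eqVlt ltNge sqr_ge0 orbF sqrf_eq0 => /eqP ->.
have [y y1 {1}->] := A_normalize nnA x0.
rewrite /B /= (linear_funZ _ _ bT.1) (linear_funZ _ _ bS.1).
by rewrite A_normZr ?A_norm_ge0// mulrC ler_wpM2r ?A_norm_ge0 ?Bunit.
Qed.

(** In the seminorm, [|S x|^2 = <T S x, x> <= |T| |S x| |x|], and [|S x|] cancels. This is how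
    [sharp A P] and [sharp A Q] get bounded by [P] and [Q]. *)
Lemma A_adjoint_le_opnorm T S x : A_adjointable A T -> A_adjoint A T S ->
  A_norm A (S x) <= A_opnorm A T * A_norm A x.
Proof.
move=> adjT adjS; have TA := A_adjointable_A_bounded adjT.
have [->|Sx] := eqVneq (A_norm A (S x)) 0.
  by rewrite mulr_ge0 ?A_norm_ge0 ?A_opnorm_ge0.
have Sx0 : 0 < A_norm A (S x) by rewrite lt_def Sx A_norm_ge0.
rewrite -(ler_pM2l Sx0) -expr2.
have -> : A_norm A (S x) ^+ 2 = complex.Re `|A_inner A (T (S x)) x|.
  apply: (@complexI R); rewrite Re_normK (A_adjoint_inner _ _ posA adjT.1 adjS).
  by rewrite -(A_normE nnA) ger0_norm// ler0c sqr_ge0.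
apply: le_trans (A_cauchy_schwarz nnA _ _) _.
by rewrite mulrCA mulrA ler_wpM2r ?A_norm_ge0// A_norm_le_opnorm.
Qed.

End AAdjointable.

(** * Block operators on the direct sum *)

Section Block.
Context {R : realType} {H : hilbertType R}.
Context (A : H -> H) (nnA : nonneg_linear A).

Let AA : hsum H H -> hsum H H := block_op A \0 \0 A.

Lemma block_innerE (z w : hsum H H) :
  A_inner AA z w = A_inner A z.1 w.1 + A_inner A z.2 w.2.
Proof.
by rewrite {1}/A_inner /AA /block_op /= addr0 add0r.
Qed.

Lemma block_nonneg_linear : nonneg_linear AA.
Proof.
split=> [a z w|z].
  by rewrite /AA /block_op /= !addr0 !add0r !nnA.1.
by rewrite -/(A_inner AA z z) block_innerE addr_ge0// nnA.2.
Qed.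

Lemma block_normE (z : hsum H H) :
  A_norm AA z ^+ 2 = A_norm A z.1 ^+ 2 + A_norm A z.2 ^+ 2.
Proof.
apply: (@complexI R); rewrite [RHS]realcD (A_normE block_nonneg_linear).
by rewrite !(A_normE nnA) block_innerE.
Qed.

Lemma block_A_bounded X Y : A_bounded A X -> A_bounded A Y ->
  A_bounded AA (block_op \0 X Y \0).
Proof.
move=> [XL [c c0 cP]] [YL [d d0 dP]]; split=> [a z w|].
  by rewrite /block_op /= !add0r !addr0 XL YL.
exists (c + d) => [|z]; first exact: addr_ge0.
rewrite -(ler_pXn2r (n := 2)) ?nnegrE ?mulr_ge0 ?addr_ge0 ?A_norm_ge0//.
rewrite exprMn !block_normE /block_op /= add0r addr0 mulrDr [leRHS]addrC.
apply: lerD; rewrite -exprMn ler_pXn2r ?nnegrE ?mulr_ge0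
  ?addr_ge0 ?A_norm_ge0//.
  by rewrite (le_trans (cP _))// ler_wpM2r ?A_norm_ge0// lerDl.
by rewrite (le_trans (dP _))// ler_wpM2r ?A_norm_ge0// lerDr.
Qed.

(** The left-hand side is the modulus of the quadratic form of the off-diagonal block operator at
    [(u, v)]. *)
Lemma block_offdiag_le (X Y : H -> H) u v :
  A_bounded A X -> A_bounded A Y ->
  complex.Re `|A_inner A (X v) u + A_inner A (Y u) v| <=
  A_numradius AA (block_op \0 X Y \0) * (A_norm A u ^+ 2 + A_norm A v ^+ 2).
Proof.
move=> bX bY.
have := A_inner_le_numradius block_nonneg_linear (u, v) (block_A_bounded bX bY).
by rewrite block_normE block_innerE /block_op /= add0r addr0.
Qed.

End Block.

(** Here [s] stands for [t ^ 2], [m] for [|<T x, x>|] and [n] for [|T x|]. The summands are at most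
    [(al G)^2] and [(G F)^2]; the second bound rests on [n ^ 2 <= G F], a weighted Cauchy-Schwarz
    inequality in which [G F - (p b + q a)^2] is a square. *)
Lemma DW_scalar_bound (R : realFieldType) (s a b p q al m n : R) : 0 < s ->
  0 <= a -> 0 <= b -> 0 <= p -> 0 <= q -> 0 <= m -> 0 <= n ->
  m <= al * (s * a ^+ 2 + s^-1 * b ^+ 2) -> n <= p * b + q * a ->
  m ^+ 2 + n ^+ 4 <= (s * a ^+ 2 + s^-1 * b ^+ 2) ^+ 2 *
    ((s * p ^+ 2 + s^-1 * q ^+ 2) ^+ 2 + al ^+ 2).
Proof.
move=> s0 a0 b0 p0 q0 m0 n0 mle nle.
set G := s * a ^+ 2 + s^-1 * b ^+ 2 in mle *; set F := s * p ^+ 2 + _.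
have n2 : n ^+ 2 <= G * F.
  apply: (@le_trans _ _ ((p * b + q * a) ^+ 2)).
    by rewrite ler_pXn2r ?nnegrE ?addr_ge0 ?mulr_ge0.
  rewrite -subr_ge0.
  have -> : G * F - (p * b + q * a) ^+ 2 = (s * p * a - s^-1 * q * b) ^+ 2.
    by rewrite /G /F; field; rewrite gt_eqF.
  exact: sqr_ge0.
rewrite mulrDr addrC -!exprMn lerD//.
  by rewrite (exprM n 2 2) ler_pXn2r ?nnegrE ?sqr_ge0// (le_trans (sqr_ge0 n)).
by rewrite mulrC ler_pXn2r ?nnegrE// (le_trans m0).
Qed.

(** * The bound for both signs *)

Section Main.
Context {R : realType} {H : hilbertType R}.
Context (A : H -> H) (posA : positive_op A).
Let nnA := positive_nonneg_linear posA.

(** A unimodular [z] encodes the sign through [z^* ^+ 2], so one computation serves the sum and the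
    difference. *)
Lemma A_DWradius_phase_le (P Q X Y P' Q' : H -> H) (t : R) (z : R[i]) :
  A_adjointable A P -> A_adjointable A Q ->
  A_adjointable A X -> A_adjointable A Y ->
  A_adjoint A P P' -> A_adjoint A Q Q' -> t != 0 -> `|z| = 1 ->
  A_DWradius A (fun x => P (X (Q' x)) + (z^* ^+ 2) *: Q (Y (P' x))) ^+ 2 <=
  (t ^+ 2 * A_opnorm A P ^+ 2 + (t ^+ 2)^-1 * A_opnorm A Q ^+ 2) ^+ 2 *
    ((t ^+ 2 * A_opnorm A (P \o X) ^+ 2
      + (t ^+ 2)^-1 * A_opnorm A (Q \o Y) ^+ 2) ^+ 2
     + A_numradius (block_op A \0 \0 A) (block_op \0 X Y \0) ^+ 2).
Proof.
move=> adP adQ adX adY adP' adQ' t0 z1.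
have bX := A_adjointable_A_bounded posA adX.
have bY := A_adjointable_A_bounded posA adY.
have bPX := A_bounded_comp (A_adjointable_A_bounded posA adP) bX.
have bQY := A_bounded_comp (A_adjointable_A_bounded posA adQ) bY.
set al := A_numradius _ _; set a := A_opnorm A P; set b := A_opnorm A Q.
set p := A_opnorm A (P \o X); set q := A_opnorm A (Q \o Y).
have al0 : 0 <= al by exact: A_numradius_ge0.
have [a0 b0 p0 q0] : [/\ 0 <= a, 0 <= b, 0 <= p & 0 <= q].
  by split; exact: A_opnorm_ge0.
have s0 : 0 < t ^+ 2 by rewrite exprn_even_gt0.
set bound := (X in _ <= X).
pose T x := P (X (Q' x)) + (z^* ^+ 2) *: Q (Y (P' x)).
have zc : z * z^* = 1 by rewrite -normCK z1 expr1n.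
have zc1 : `|z^*| = 1 by rewrite norm_conjC.
have key x : A_norm A x = 1 ->
    complex.Re `|A_inner A (T x) x| ^+ 2 + A_norm A (T x) ^+ 4 <= bound.
  move=> x1.
  have Ple : A_norm A (P' x) <= a.
    by have := A_adjoint_le_opnorm posA x adP adP'; rewrite x1 mulr1.
  have Qle : A_norm A (Q' x) <= b.
    by have := A_adjoint_le_opnorm posA x adQ adQ'; rewrite x1 mulr1.
  apply: DW_scalar_bound; rewrite ?Re_norm_ge0 ?A_norm_ge0//.
    have := block_offdiag_le nnA (t%:C *: P' x) ((z * t^-1%:C) *: Q' x) bX bY.
    rewrite (linear_funZ _ _ bX.1) (linear_funZ _ _ bY.1).
    rewrite !(A_innerZl nnA) !A_innerZr !(A_normZ nnA) -/al !exprMn.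
    have -> : complex.Re `|t%:C| ^+ 2 = t ^+ 2.
      apply: (@complexI R); rewrite realcX Re_normK -add_Re2_Im2/=.
      by rewrite expr0n addr0.
    have -> : complex.Re `|z * t^-1%:C| ^+ 2 = (t ^+ 2)^-1.
      apply: (@complexI R); rewrite realcX Re_normK normrM z1 mul1r.
      by rewrite -add_Re2_Im2/= expr0n addr0 exprVn.
    (* The powers of [t] cancel in the cross terms and leave the coefficients [z] and
       [z^* = z * z^* ^+ 2]. *)
    have -> : z * t^-1%:C * ((t%:C)^* * A_inner A (X (Q' x)) (P' x))
          + t%:C * ((z * t^-1%:C)^* * A_inner A (Y (P' x)) (Q' x)) =
        z * A_inner A (T x) x.
      rewrite /T (A_innerDl nnA) (A_innerZl nnA).
      rewrite (A_adjoint_inner _ _ posA adP.1 adP').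
      rewrite (A_adjoint_inner _ _ posA adQ.1 adQ').
      have -> : (t%:C)^* = t%:C by exact: conjc_real.
      rewrite rmorphM/=; have -> : (t^-1%:C)^* = t^-1%:C by exact: conjc_real.
      have tt : t^-1%:C * t%:C = 1 by rewrite -realcM mulVf.
      ring: tt zc.
    rewrite normrM z1 mul1r.
    move=> /le_trans; apply; rewrite ler_wpM2l// lerD//;
      rewrite ler_wpM2l ?invr_ge0 ?(ltW s0)//.
    - by rewrite ler_pXn2r ?nnegrE ?A_norm_ge0.
    - by rewrite ler_pXn2r ?nnegrE ?A_norm_ge0.
  (* The phase has modulus 1, and [P \o X] and [Q \o Y] are each bounded as a single operator. *)
  rewrite (le_trans (A_normD nnA _ _))// (A_normZ nnA) normrX zc1 expr1n mul1r.
  apply: lerD.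
    rewrite (le_trans (A_norm_le_opnorm nnA (Q' x) bPX))//.
    by rewrite ler_wpM2l.
  rewrite (le_trans (A_norm_le_opnorm nnA (P' x) bQY))//.
  by rewrite ler_wpM2l.
have bound0 : 0 <= bound.
  by rewrite mulr_ge0 ?addr_ge0 ?sqr_ge0.
rewrite -[leRHS]sqr_sqrtr// ler_pXn2r ?nnegrE ?sqrtr_ge0 ?A_DWradius_ge0//.
rewrite /A_DWradius; set E := image _ _.
(* Without vectors of seminorm 1 the supremum is 0. *)
have [E0|/set0P/negP/negPn/eqP ->] := pselect (E !=set0); last first.
  by rewrite sup0 sqrtr_ge0.
apply: ge_sup => // _ [x /= x1 <-].
by rewrite ler_wsqrtr// key.
Qed.

End Main.

Theorem theorem2p30 (R : realType) (H : hilbertType R) (A P Q X Y : H -> H)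
    (t : R) :
  positive_op A ->
  A_adjointable A P -> A_adjointable A Q ->
  A_adjointable A X -> A_adjointable A Y ->
  t != 0 ->
  let alpha := A_numradius (block_op A \0 \0 A) (block_op \0 X Y \0) in
  let bound :=
    (t ^+ 2 * A_opnorm A P ^+ 2 + (t ^+ 2)^-1 * A_opnorm A Q ^+ 2) ^+ 2 *
    ((t ^+ 2 * A_opnorm A (P \o X) ^+ 2
      + (t ^+ 2)^-1 * A_opnorm A (Q \o Y) ^+ 2) ^+ 2 + alpha ^+ 2) in
  A_DWradius A ((P \o X \o sharp A Q) \+ (Q \o Y \o sharp A P)) ^+ 2 <= bound /\
  A_DWradius A ((P \o X \o sharp A Q) \- (Q \o Y \o sharp A P)) ^+ 2 <= bound.
Proof.
move=> posA adP adQ adX adY t0 alpha bound.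
have main z := @A_DWradius_phase_le _ _ _ posA P Q X Y _ _ t z adP adQ adX adY
  (sharpP posA adP) (sharpP posA adQ) t0.
split.
  (* [z = 1] gives the sum, and [z = 'i], for which [z^* ^+ 2 = -1], the difference. *)
  have := main 1 (normr1 _); congr (A_DWradius A _ ^+ 2 <= _).
  by apply/funext => x /=; rewrite conjC1 expr1n scale1r.
have := main 'i (normCi _); congr (A_DWradius A _ ^+ 2 <= _).
by apply/funext => x /=; rewrite conjCi sqrrN sqrCi scaleN1r.
Qed.
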